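(* For every $n\geq 1$, $$\sum_{\pi\in\mathcal{S}_n(\underline{32}1)}q^{\mathrm{inv}(\pi)}t^{\mathrm{des}(\pi)}=\sum_{w\in W_n}q^{\mathrm{inv}(w)+n-\mathrm{L}(w)}t^{\mathrm{rp}(w)}=q^n\sum_{w\in W_n}q^{\mathrm{inv}(w)-\mathrm{L}(w)}t^{\mathrm{rp}(w)}.$$
   Context: $\mathcal{S}_n$ is the set of permutations $\pi=\pi_1\pi_2\cdots\pi_n$ of $[n]=\{1,\dots,n\}$. A permutation $\pi\in\mathcal{S}_n$ contains the vincular pattern $\underline{32}1$ if there are indices $i,j$ with $1\le i$, $i+1<j\le n$ and $\pi_i>\pi_{i+1}>\pi_j$ (the entries playing the roles of 3 and 2 must be adjacent); otherwise it avoids it. $\mathcal{S}_n(\underline{32}1)$ is the set of $\pi\in\mathcal{S}_n$ avoiding $\underline{32}1$. For a permutation or, more generally, a word $u=u_1\cdots u_n$ of positive integers, $\mathrm{inv}(u)=|\{(i,j): i<j,\ u_i>u_j\}|$. An index $i\in[n-1]$ is a descent of $\pi$ if $\pi_i>\pi_{i+1}$, and $\mathrm{des}(\pi)$ is the number of descents of $\pi$. A restricted-growth word of length $n$ is a word $w=w_1w_2\cdots w_n$ of positive integers with $w_1=1$ and $1\le w_i\le 1+\max\{w_1,\dots,w_{i-1}\}$ for all $1<i\le n$. $W_n$ is the set of restricted-growth words of length $n$. For $w\in W_n$, $\mathrm{L}(w)$ is the largest letter of $w$, and $\mathrm{rp}(w)=\sum_{i=1}^n r_i(w)$, where $r_i(w)=1$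 if the letter $i$ appears more than once in $w$ and $r_i(w)=0$ if it appears at most once (so $\mathrm{rp}(w)$ is the number of distinct letters that are repeated in $w$). *)

(* Defs.v *)
From HB Require Import structures.
From mathcomp Require Import all_boot all_order all_fingroup all_algebra.

Set Implicit Arguments.
Unset Strict Implicit.
Unset Printing Implicit Defensive.

(* Words are functions u : 'I_n -> nat, with positions numbered from 0.  A
   permutation p in 'S_n is the word of its values val \o p, which run over
   0, ..., n.-1 instead of 1, ..., n; only comparisons between values matter. *)

Section Words.
Variable n : nat.
Implicit Type u : 'I_n -> nat.

Definition inversions u : nat :=
  #|[set p : 'I_n * 'I_n | (p.1 < p.2) && (u p.2 < u p.1)]|.

Definition descents u : nat :=
  #|[set i : 'I_n | [exists j : 'I_n, (j == i.+1 :> nat) && (u j < u i)]]|.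

Definition contains_u32_1 u : bool :=
  [exists i : 'I_n, exists i' : 'I_n, exists j : 'I_n,
    [&& i' == i.+1 :> nat, i' < j, u i' < u i & u j < u i']].

Definition rgword u : bool :=
  [forall i : 'I_n,
    if i == 0 :> nat then u i == 1
    else 1 <= u i <= 1 + \max_(j < n | j < i) u j].

Definition largest u : nat := \max_(i < n) u i.

Definition repeated u : nat :=
  \sum_(1 <= k < n.+1) (1 < #|[set i | u i == k]|).

End Words.

Definition Sn_avoid (n : nat) : {set 'S_n} :=
  [set p : 'S_n | ~~ contains_u32_1 (val \o p)].

(* The letters of a restricted-growth word of length n are at most n (lemma
   rgword_le below), so that 'I_n.+1 is a large enough alphabet (rgword_W). *)
Definition W (n : nat) : {set {ffun 'I_n -> 'I_n.+1}} :=
  [set w : {ffun 'I_n -> 'I_n.+1} | rgword (val \o w)].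

Lemma rgword_le n (u : 'I_n -> nat) (i : 'I_n) : rgword u -> u i <= i.+1.
Proof.
move=> /forallP rgu; have [m] := ubnP i; elim: m i => // m IHm i le_im.
have := rgu i; case: eqP => [_ /eqP-> // | _ /andP[_ /leq_trans]]; apply.
rewrite add1n ltnS; apply/bigmax_leqP => j ltji.
have ltjm : j < m by exact: leq_trans ltji _.
exact: leq_trans (IHm j ltjm) ltji.
Qed.

Lemma rgword_W n (u : 'I_n -> nat) :
  rgword u -> exists2 w, w \in W n & val \o w =1 u.
Proof.
move=> rgu; pose w := [ffun i => inord (u i) : 'I_n.+1].
have wE : val \o w =1 u.
  move=> i; rewrite /= ffunE inordK // ltnS.
  exact: leq_trans (rgword_le i rgu) (ltn_ord i).
exists w => //; rewrite inE; apply/forallP=> i; move/forallP/(_ i): rgu.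
have -> // : \max_(j < n | j < i) (val \o w) j = \max_(j < n | j < i) u j.
  by apply: eq_bigr => j _; rewrite wE.
by rewrite wE.
Qed.

(* Hence truncated subtractions of the form k + n - largest u are exact. *)
Lemma largest_le n (u : 'I_n -> nat) : rgword u -> largest u <= n.
Proof.
move=> rgu; apply/bigmax_leqP => i _.
exact: leq_trans (rgword_le i rgu) (ltn_ord i).
Qed.

(* Main.v *)
Require Import Defs.
From HB Require Import structures.
From mathcomp Require Import all_boot all_order all_fingroup all_algebra.
From mathcomp Require Import zify.

(** Both sums enumerate the partitions of the set of values, and the two
    statistics agree partition by partition.

    A word [w] is read as a partition: [w v] is the index of the block that
    contains the value [v].  Restricted growth says that the blocks are numbered
    by increasing minima, and the minimum of a block is the first occurrence of
    its letter.  A permutation avoids the pattern exactly when each of its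
    descent bottoms is a right-to-left minimum ([avoidP]).  Cutting such a
    permutation after each right-to-left minimum therefore gives factors that
    increase up to their last entry, and this last entry is their minimum.  The
    factors are the blocks of a partition, listed by increasing minima, and the
    permutation is recovered by writing the blocks in this order, each of them
    increasingly except that its minimum comes last.  The predicate [lists w p]
    says that [p] is written from [w] in this way.  It is a bijection between
    [W n] and [Sn_avoid n]: each word is listed by one permutation
    ([ex_lists], [lists_inj]), which avoids the pattern ([lists_avoid]) and
    determines the word ([lists_block]); each avoiding permutation lists the
    word of its factors ([avoid_lists], [block_rgword]).

    Let [p] list [w].  An inversion of [p] is a pair of values [a < b] with [b]
    written before [a].  Either the block of [b] precedes the block of [a], and
    [(a, b)] is an inversion of [w], or both lie in one block whose minimum
    is [a], and such a pair is given by a value [b] that is not the minimum of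
    its block; there are [n - largest w] of these ([lists_inversions]).  A
    descent of [p] occurs exactly before the last entry of a factor with at
    least two entries, so descents correspond to repeated letters
    ([lists_descents]). *)

Set Implicit Arguments.
Unset Strict Implicit.
Unset Printing Implicit Defensive.
Import GRing.Theory.
Local Open Scope ring_scope.

(** * Restricted-growth words *)

Section FirstOccurrences.
Local Open Scope nat_scope.
Variables (n : nat) (w : 'I_n -> nat).
Implicit Types u v m : 'I_n.

Definition first v := [forall u : 'I_n, (u < v) ==> (w u != w v)].

Lemma firstP v : reflect (forall u, u < v -> w u <> w v) (first v).
Proof.
by apply: (iffP forallP) => [fv u ltuv | fv u];
  [exact/eqP/(implyP (fv u)) | apply/implyP => /fv/eqP].
Qed.

Lemma ex_first v : exists2 m, first m & (m <= v) /\ w m = w v.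
Proof.
case: (@arg_minnP _ v (fun m => w m == w v) val (eqxx _)) => m /eqP eqm minm.
exists m; last by split; rewrite ?minm.
apply/firstP => u ltum equ; have := minm u; rewrite equ eqm eqxx => /(_ isT).
by rewrite leqNgt ltum.
Qed.

Lemma first_inj : {in first &, injective w}.
Proof.
move=> u v /firstP fu /firstP fv eqw; apply/val_inj.
by case: (ltngtP u v) => // [/fv | /fu] [].
Qed.

(** Each letter that occurs has exactly one first occurrence, so letters may be
    counted through their first occurrences. *)
Lemma card_first (P : pred nat) (s : seq nat) :
    uniq s -> (forall k, k \in s <-> exists2 u, w u = k & P k) ->
  #|[set m | first m && P (w m)]| = size s.
Proof.
move=> us sP; rewrite cardE -(size_map w); apply/perm_size/uniq_perm => //.
  rewrite map_inj_in_uniq ?enum_uniq // => u v.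
  rewrite !mem_enum !inE => /andP[fu _] /andP[fv _]; exact: first_inj.
move=> k; apply/mapP/idP => [[m] | /sP[u <- Pu]].
  by rewrite mem_enum inE => /andP[_ Pm] ->; apply/sP; exists m.
have [m fm [_ eqm]] := ex_first u.
by exists m; rewrite // mem_enum inE fm eqm.
Qed.

Hypothesis rgw : rgword w.

Lemma rg_gt0 v : 0 < w v.
Proof. by have /forallP/(_ v) := rgw; case: ifP => [_ /eqP-> | _ /andP[]]. Qed.

(** A letter exceeds the maximum of the preceding ones by at most one, so no
    letter is passed over before it has occurred. *)
Lemma rg_occurs v k : 0 < k <= w v -> exists2 u : 'I_n, u <= v & w u = k.
Proof.
have [N] := ubnP (v : nat); elim: N v => // N IH v leN /andP[k0 kv].
have [-> | ltk] := eqVneq k (w v); first by exists v.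
have /forallP/(_ v) := rgw; case: ifP => [_ /eqP w1 | _ /andP[_ lew]].
  by move: kv ltk; rewrite w1; lia.
have [u /andP[ltuv ku]] : exists u : 'I_n, (u < v) && (k <= w u).
  apply/existsP; apply: contraT; rewrite negb_exists => /forallP noex.
  suff : \max_(j < n | j < v) w j <= k.-1 by lia.
  apply/bigmax_leqP => j ltjv; have := noex j; rewrite ltjv /=; lia.
have [|//|x lexu <-] := IH u; [lia | by rewrite k0 |].
by exists x => //; lia.
Qed.

Lemma rg_first_gt v u : first v -> u < v -> w u < w v.
Proof.
move=> /firstP fv ltuv; rewrite ltnNge; apply/negP => le_vu.
have [|x lexu /fv[]] := @rg_occurs u (w v); first by rewrite rg_gt0.
exact: leq_ltn_trans ltuv.
Qed.

Lemma rg_card_first_lt v : #|[set m | first m && (w m < w v)]| = (w v).-1.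
Proof.
rewrite (@card_first (fun k => k < w v) (iota 1 (w v).-1)) ?size_iota //.
  exact: iota_uniq.
move=> k; rewrite mem_iota; split=> [kv | [u <- /= ltuv]].
  have [|u _ eqk] := @rg_occurs v k; first by lia.
  by exists u => //; lia.
by have := rg_gt0 u; lia.
Qed.

Lemma rg_card_first : #|[set m | first m]| = largest w.
Proof.
transitivity #|[set m | first m && xpredT (w m)]|.
  by apply: eq_card => m; rewrite !inE andbT.
rewrite (@card_first xpredT (iota 1 (largest w))) ?size_iota ?iota_uniq //.
move=> k; rewrite mem_iota; split=> [kL | [u <- _]]; last first.
  by rewrite rg_gt0 add1n ltnS (leq_bigmax u).
have [v kv] : exists v, k <= w v.
  apply/existsP; apply: contraT; rewrite negb_exists => /forallP noex.
  suff : largest w <= k.-1 by lia.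
  by apply/bigmax_leqP => j _; have := noex j; lia.
by have [|u _ <-] := @rg_occurs v k; [lia | exists u].
Qed.

Lemma rg_repeated :
  repeated w = #|[set m | first m && (1 < #|[set u | w u == w m]|)]|.
Proof.
pose P k := 1 < #|[set u | w u == k]|.
rewrite (@card_first P (filter P (iota 1 n))) ?filter_uniq ?iota_uniq //.
  rewrite /repeated -sum1_size big_filter [RHS]big_mkcond /index_iota subn1.
  by apply: eq_bigr => k _; rewrite -/(P k); case: (P k).
move=> k; rewrite mem_filter mem_iota; split=> [/andP[Pk _] | [u <- Pu]].
  by have /card_gt0P[u] := ltnW Pk; rewrite inE => /eqP; exists u.
by rewrite Pu rg_gt0 add1n ltnS (leq_trans (rgword_le u rgw)).
Qed.

End FirstOccurrences.

Lemma eq_first n (w w' : 'I_n -> nat) : w =1 w' -> first w =1 first w'.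
Proof. by move=> eqw v; apply: eq_forallb => u; rewrite !eqw. Qed.

Lemma eq_rgword n (w w' : 'I_n -> nat) : w =1 w' -> rgword w = rgword w'.
Proof.
move=> eqw; apply: eq_forallb => i; rewrite eqw.
by under eq_bigr do rewrite eqw.
Qed.

(** * Permutations listing the blocks of a word *)

Section Listing.
Local Open Scope nat_scope.
Variable n : nat.
Implicit Types (p : 'S_n) (w : 'I_n -> nat) (a b c u v m : 'I_n).

Local Notation pos p := (p^-1)%g.

Lemma pos_eq p a b : (pos p a == pos p b :> nat) = (a == b).
Proof. by rewrite val_eqE (inj_eq perm_inj). Qed.

(** Reading [w v] as the index of the block of [v], the permutation writes the
    blocks in order, each of them increasingly except for its minimum, which
    comes last.  It is enough to compare the positions of [a < b]: within a
    block [b] precedes [a] only when [a] is the minimum. *)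
Definition lists w p := forall a b, a < b ->
  (pos p b < pos p a) = (w b < w a) || (w a == w b) && first w a.

(** Right-to-left minima, as values rather than positions. *)
Definition rlmin p v := [forall c : 'I_n, (c < v) ==> (pos p c < pos p v)].

Lemma rlminP p v :
  reflect (forall c, c < v -> pos p c < pos p v) (rlmin p v).
Proof.
by apply: (iffP forallP) => H c; [apply/implyP | apply/implyP; apply: H].
Qed.

(** An entry that is smaller than a descent bottom and comes after it is the
    last letter of an occurrence of the pattern. *)
Lemma avoidP p :
  reflect (forall i i' : 'I_n, i' = i.+1 :> nat -> p i' < p i ->
             rlmin p (p i'))
          (p \in Sn_avoid n).
Proof.
rewrite inE; apply: (iffP idP) => [av i i' eqi lti | H].
  apply/rlminP => c ltc; rewrite permK ltnNge leq_eqVlt; apply: contraNN av.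
  case/orP => [/eqP/val_inj eqc | ltpos].
    by move: ltc; rewrite eqc permKV ltnn.
  apply/existsP; exists i; apply/existsP; exists i'; apply/existsP.
  by exists (pos p c); rewrite /= permKV eqi eqxx -eqi ltpos lti ltc.
apply/negP => /existsP[i /existsP[i' /existsP[j /and4P[/eqP eqi ltj lti lt]]]].
have /rlminP/(_ (p j) lt) := H i i' eqi lti.
by rewrite !permK ltnNge (ltnW ltj).
Qed.

(** A rank function turns any injective key into a permutation. *)
Lemma standardize (f : 'I_n -> nat) :
  injective f -> exists s : 'S_n, forall a b, (s a < s b) = (f a < f b).
Proof.
move=> inj_f; pose r a := #|[set u | f u < f a]|.
have ltr a b : f a < f b -> r a < r b.
  move=> ltab; apply/proper_card/properP; split.
    by apply/subsetP => u; rewrite !inE => /ltn_trans; apply.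
  by exists a; rewrite !inE ?ltnn.
have r_lt a b : (r a < r b) = (f a < f b).
  apply/idP/idP => [ltab | /ltr //]; case: (ltngtP (f a) (f b)) => //.
    by move=> /ltr ltba; have := ltn_trans ltab ltba; rewrite ltnn.
  by move=> /inj_f eqab; move: ltab; rewrite eqab ltnn.
have r_n a : r a < n.
  rewrite -[X in _ < X]card_ord -cardsT; apply/proper_card/properP.
  by split; [apply/subsetP => u; rewrite inE | exists a; rewrite !inE ?ltnn].
have inj_r : injective (fun a => Ordinal (r_n a)).
  move=> a b [eqr]; apply: inj_f; have := r_lt a b; have := r_lt b a.
  by rewrite eqr ltnn; case: ltngtP.
by exists (perm inj_r) => a b; rewrite !permE /= r_lt.
Qed.

(** A permutation is recovered from its relative order, as [s a] is the number
    of entries below [s a]. *)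
Lemma perm_order_inj (s s' : 'S_n) :
  (forall a b, a < b -> (s b < s a) = (s' b < s' a)) -> s = s'.
Proof.
move=> H.
have posE (x : 'S_n) a b : a != b -> (x b < x a) = ~~ (x a < x b).
  move=> neab.
  by rewrite -leqNgt ltn_neqAle val_eqE (inj_eq perm_inj) eq_sym neab.
have {}H a b : (s b < s a) = (s' b < s' a).
  case: (ltngtP a b) => [/H // | ltba | /val_inj->]; last by rewrite !ltnn.
  have neab : a != b by rewrite neq_ltn ltba orbT.
  by rewrite !(posE _ _ _ neab) H.
have cardE (x : 'S_n) a : #|[set u | x u < x a]| = x a.
  transitivity #|x @^-1: [set i : 'I_n | i < x a]|.
    by apply: eq_card => u; rewrite !inE.
  rewrite card_preimset; last exact: perm_inj.
  rewrite -sum1_card; under eq_bigl do rewrite inE.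
  rewrite -(big_ord_widen n (fun=> 1)) ?sum1_card ?card_ord //.
  exact: ltnW.
apply/permP => a; apply/val_inj => /=; rewrite -(cardE s) -(cardE s').
by apply: eq_card => u; rewrite !inE H.
Qed.

Lemma ex_lists w : exists p, lists w p.
Proof.
(* The key is lexicographic: the block, then the value, where the minimum of a
   block gets [n], which exceeds all values and so puts it last. *)
pose e v : nat := if first w v then n else v.
have le_e v : e v <= n by rewrite /e; case: ifP; rewrite // ltnW.
pose f v := w v * n.+1 + e v.
have f_lt a b : (f a < f b) = (w a < w b) || (w a == w b) && (e a < e b).
  have := le_e a; have := le_e b; rewrite /f.
  by case: (ltngtP (w a) (w b)) => [lt | lt | ->]; nia.
have inj_f : injective f.
  move=> a b eqf; have := f_lt a b; have := f_lt b a; rewrite eqf ltnn.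
  case: ltngtP => //= eqw; case: ltngtP => //=; rewrite /e.
  case: ifP => fb; case: ifP => fa.
  - by move=> _ _ _; apply: (first_inj fa fb).
  - by move=> eqa; have := ltn_ord a; rewrite -eqa ltnn.
  - by move=> eqb; have := ltn_ord b; rewrite eqb ltnn.
  - by move=> /val_inj.
have [s sP] := standardize inj_f; exists s^-1%g => a b ltab.
rewrite invgK sP f_lt; congr orb; rewrite eq_sym; case: eqP => //= eqw.
have /negPf nfb : ~~ first w b by apply/firstP => /(_ a ltab).
by rewrite /e nfb; case: ifP => _; rewrite ?ltn_ord // ltnNge ltnW.
Qed.

Lemma eq_lists w w' p : w =1 w' -> lists w p -> lists w' p.
Proof. by move=> eqw wp a b ltab; rewrite wp // !eqw (eq_first eqw). Qed.

Lemma lists_inj w p p' : lists w p -> lists w p' -> p = p'.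
Proof.
move=> wp wp'; apply: invg_inj; apply: perm_order_inj => a b ltab.
by rewrite wp // wp'.
Qed.

(** * From words to permutations *)

Section WordToPerm.
Variables (w : 'I_n -> nat) (p : 'S_n).
Hypotheses (rgw : rgword w) (wp : lists w p).

Lemma lists_lt u v : w u < w v -> pos p u < pos p v.
Proof.
move=> ltw; have neuv : u != v by apply: contraTneq ltw => ->; rewrite ltnn.
case: (ltngtP u v) => [ltuv | ltvu | /val_inj equv].
- have := wp ltuv; rewrite [w v < _]ltnNge (ltnW ltw) (ltn_eqF ltw) /=.
  by move=> /negbT; rewrite -leqNgt leq_eqVlt pos_eq (negPf neuv).
- by rewrite wp // ltw.
- by rewrite equv eqxx in neuv.
Qed.

Lemma lists_le u v : pos p u <= pos p v -> w u <= w v.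
Proof. by rewrite leqNgt; apply: contraNleq => /lists_lt. Qed.

Lemma first_last m v : first w m -> w v = w m -> pos p v <= pos p m.
Proof.
move=> fm eqw; have [-> // | nevm] := eqVneq v m.
have /firstP nlt := fm.
have ltmv : m < v.
  by case: (ltngtP m v) nevm => // [/nlt | /val_inj->]; rewrite ?eqxx.
by apply: ltnW; rewrite wp // eqw eqxx fm orbT.
Qed.

(** By restricted growth, a value smaller than the minimum of a block lies in an
    earlier block, hence is written before that minimum.  Any other value is
    followed by the minimum of its block. *)
Lemma first_rlmin v : first w v = rlmin p v.
Proof.
apply/idP/rlminP => [fv c ltcv | minv].
  exact: lists_lt (rg_first_gt rgw fv ltcv).
have [m fm [lemv eqm]] := ex_first w v.
have [<- // | nemv] := eqVneq m v.
have ltmv : m < v by rewrite ltn_neqAle val_eqE nemv.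
by have := minv m ltmv; rewrite ltnNge first_last.
Qed.

(** No descent crosses from one block to the next: it would start at the minimum
    of a block, which is a right-to-left minimum. *)
Lemma lists_descent (i i' : 'I_n) :
  i' = i.+1 :> nat -> p i' < p i -> w (p i) = w (p i') /\ first w (p i').
Proof.
move=> eqi ltp; have := wp ltp; rewrite !permK eqi ltnSn.
case/esym/orP => [ltw | /andP[/eqP-> -> //]].
have [m fm [_ eqm]] := ex_first w (p i).
have le_im : i <= pos p m by have := first_last fm (esym eqm); rewrite permK.
have : pos p m < i' by rewrite -[X in _ < nat_of_ord X](permK p) lists_lt ?eqm.
(* The minimum [m] of the block of [p i] lies at or after position [i] and
   before [i.+1], hence equals [p i]. *)
rewrite eqi ltnS => le_mi.
have im : i = pos p m by apply/val_inj/eqP; rewrite eqn_leq le_im.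
move: fm; rewrite -(permKV p m) -im => /(rg_first_gt rgw)/(_ ltp).
by rewrite ltnNge ltnW.
Qed.

Lemma lists_avoid : p \in Sn_avoid n.
Proof.
apply/avoidP => i i' eqi /(lists_descent eqi)[_].
by rewrite first_rlmin.
Qed.

(** Inversions of [p], read as pairs of values, split into the inversions of [w]
    (the set [A]) and the pairs formed by the minimum of a block and another
    value of the same block (the set [B]). *)
Lemma lists_inversions : inversions (val \o p) = inversions w + n - largest w.
Proof.
pose A := [set x : 'I_n * 'I_n | (x.1 < x.2) && (w x.2 < w x.1)].
pose B := [set x : 'I_n * 'I_n | [&& x.1 < x.2, w x.1 == w x.2 & first w x.1]].
pose F := [set m | first w m].
(* A pair in [B] is determined by its larger value, which is any non-minimum. *)
have cardB : #|B| = n - largest w.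
  rewrite -(rg_card_first rgw) -/F -[F]setCK -[X in X - _]card_ord -cardsCs.
  transitivity #|[set x.2 | x in B]|.
    rewrite card_in_imset // => -[a b] [a' b']; rewrite !inE /=.
    move=> /and3P[_ /eqP eqw fa] /and3P[_ /eqP eqw' fa'] eqb.
    rewrite -eqb in eqw' *; congr pair.
    by apply: (first_inj fa fa'); rewrite eqw.
  apply: eq_card => b; rewrite !inE; apply/imsetP/idP => [[[a c]] | nfb].
    rewrite inE /= => /and3P[ltac /eqP eqw fa] ->.
    by apply/firstP => /(_ a ltac).
  have [m fm [lemb eqm]] := ex_first w b.
  exists (m, b); rewrite // inE /= eqm eqxx fm ltn_neqAle lemb val_eqE !andbT.
  by apply: contraNneq nfb => <-.
rewrite -addnBA ?largest_le // -cardB -[inversions w]/#|A|.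
have <- : #|A :|: B| = #|A| + #|B|.
  rewrite -cardsUI (_ : A :&: B = set0) ?cards0 ?addn0 //; apply/setP => x.
  by rewrite !inE; case: (ltngtP (w x.1) (w x.2)); rewrite !andbF.
pose h (x : 'I_n * 'I_n) := (p x.2, p x.1).
have inj_h : injective h by move=> [a b] [c d] [/perm_inj-> /perm_inj->].
rewrite /inversions -(card_imset _ inj_h); apply: eq_card => -[a b].
apply/imsetP/idP => [[[i j]] | ].
  rewrite !inE /= => /andP[ltij ltp] [-> ->]; rewrite ltp /=.
  by rewrite -wp // !permK.
rewrite !inE /= -andb_orr => /andP[ltab]; rewrite -wp // => ltpos.
by exists (pos p b, pos p a); rewrite ?inE /= /h /= !permKV // ltpos.
Qed.

(** Descents are counted by their bottoms, which are the minima of the blocks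
    with at least two values. *)
Lemma lists_descents : descents (val \o p) = repeated w.
Proof.
rewrite (rg_repeated rgw) /descents.
(* [ordS] wraps around at the last position, which is never a descent. *)
pose g (i : 'I_n) := p (ordS i).
have inj_g : injective g by move=> i j /perm_inj/ordS_inj.
rewrite -(card_imset _ inj_g); apply: eq_card => m; rewrite !inE.
apply/imsetP/andP => [[i] | [fm rep]].
  rewrite inE => /existsP[j /andP[/eqP eqj /= ltp]] ->.
  have -> : g i = p j.
    by congr (p _); apply/val_inj; rewrite /= -eqj modn_small.
  have [eqw fj] := lists_descent eqj ltp; split=> //.
  apply/card_gt1P; exists (p i), (p j); rewrite !inE eqw eqxx; split=> //.
  by apply: contraTneq ltp => ->; rewrite ltnn.
have /card_gt1P[x [y []]] := rep; rewrite !inE => /eqP wx /eqP wy nexy.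
(* A value [x] other than [m] in the block of [m] is written before [m], so the
   entry just before [m] belongs to this block as well, and exceeds [m]. *)
wlog nexm : x y wx wy nexy / x != m.
  move=> IH; have [eqxm | nexm] := eqVneq x m; last exact: (IH x y).
  by apply: (IH y x) => //; rewrite -?eqxm eq_sym.
have ltpos : pos p x < pos p m.
  by rewrite ltn_neqAle pos_eq nexm first_last.
have lti : (pos p m).-1 < n by have := ltn_ord (pos p m); lia.
pose i := Ordinal lti; have eqi : pos p m = i.+1 :> nat by rewrite /=; lia.
have gi : g i = m.
  apply: (canLR (permKV p)); apply/val_inj.
  by rewrite /= -[X in X %% _]eqi modn_small.
exists i; rewrite ?gi // inE; apply/existsP; exists (pos p m).
rewrite eqi eqxx /= permKV.
have wi : w (p i) = w m.
  apply/eqP; rewrite eqn_leq -{2}wx !lists_le ?permK //= ; lia.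
have /firstP nlt := fm; case: ltngtP => // [/nlt // | /val_inj eqm].
by move: eqi; rewrite {1}eqm permK; lia.
Qed.

End WordToPerm.

(** * From permutations to words *)

(** The index of the factor of [v] when [p] is cut after each right-to-left
    minimum; the factors are numbered from 1, as letters are. *)
Definition block p v := #|[set m | rlmin p m && (pos p m < pos p v)]|.+1.

(** The right-to-left minima before [v] are the minima of the blocks that
    precede the block of [v], and their letters are all the letters below
    [w v]. *)
Lemma lists_block w p : rgword w -> lists w p -> w =1 block p.
Proof.
move=> rgw wp v; rewrite -[LHS](prednK (rg_gt0 rgw v)) -rg_card_first_lt //.
congr _.+1; apply: eq_card => m; rewrite !inE -(first_rlmin rgw wp).
case fm: (first w m) => //=; apply/idP/idP => [/(lists_lt wp) // | ltpos].
rewrite ltn_neqAle (lists_le wp (ltnW ltpos)) andbT.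
apply: contraTneq ltpos => eqw; rewrite -leqNgt.
exact: (first_last wp fm (esym eqw)).
Qed.

Section PermToWord.
Variable p : 'S_n.

Lemma block_mono a b : pos p a <= pos p b -> block p a <= block p b.
Proof.
move=> leab; rewrite ltnS; apply/subset_leq_card/subsetP => m; rewrite !inE.
by case/andP => -> /leq_trans; apply.
Qed.

Lemma block_lt a b m :
  rlmin p m -> pos p a <= pos p m < pos p b -> block p a < block p b.
Proof.
move=> minm /andP[leam ltmb]; rewrite ltnS; apply/proper_card/properP; split.
  apply/subsetP => x; rewrite !inE => /andP[-> ltx].
  exact: ltn_trans (leq_trans ltx leam) ltmb.
by exists m; rewrite !inE minm ?ltmb // -leqNgt.
Qed.

(** The least value at or after the position of [v] is the right-to-left minimum
    that closes the factor of [v]. *)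
Lemma block_end v :
  exists2 m, rlmin p m
    & [/\ pos p v <= pos p m, m <= v & block p m = block p v].
Proof.
case: (@arg_minnP _ v (fun m => pos p v <= pos p m) val (leqnn _)).
move=> m lem minm.
have rlm : rlmin p m.
  apply/rlminP => c; apply: contraTT; rewrite -!leqNgt => lemc.
  exact/minm/(leq_trans lem).
exists m => //; split; [by [] | exact: minm | congr _.+1; apply: eq_card => x].
rewrite !inE; case rlx: (rlmin p x) => //=; apply/idP/idP => [ltxm | ltxv].
  rewrite ltnNge; apply/negP => /minm /=; rewrite leq_eqVlt => /orP[/eqP|].
    by move=> /val_inj eqmx; rewrite eqmx ltnn in ltxm.
  by move=> /(rlminP _ _ rlx); rewrite ltnNge ltnW.
exact: leq_trans lem.
Qed.

(** The right-to-left minimum closing a factor is also its least value, because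
    [block_end] bounds each value of the factor by it. *)
Lemma block_first v : first (block p) v = rlmin p v.
Proof.
have [m rlm [lem lemv eqb]] := block_end v.
apply/idP/idP => [/firstP fv | rlv].
  move: lemv; rewrite leq_eqVlt => /orP[/eqP/val_inj<- // | /fv].
  by rewrite eqb.
apply/firstP => c ltcv eqc; have [x rlx [lecx lexc eqx]] := block_end c.
have ltx : pos p x < pos p v.
  by apply: (rlminP _ _ rlv); apply: leq_ltn_trans ltcv.
have := block_lt rlx (introT andP (conj (leqnn _) ltx)).
by rewrite eqx eqc ltnn.
Qed.

(** The last right-to-left minimum [m] written before [v] lies in the preceding
    factor, and [m < v]; so the index of [v] exceeds that of a smaller value by
    one at most. *)
Lemma block_rgword : rgword (block p).
Proof.
apply/forallP => v.
have [v0 | v_neq0] := eqVneq (v : nat) 0.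
  rewrite eqSS cards_eq0; apply/eqP/setP => m; rewrite !inE; apply/negP.
  case/andP => /rlminP rlm ltm; case: (ltngtP v m) => [/rlm | | /val_inj eqv].
  - by rewrite ltnNge ltnW.
  - by rewrite v0.
  - by move: ltm; rewrite eqv ltnn.
rewrite /= add1n ltnS.
have [-> | [m0]] := set_0Vmem [set m | rlmin p m && (pos p m < pos p v)].
  by rewrite cards0.
rewrite inE => m0P.
have [m /andP[rlm ltm] maxm] :=
  @arg_maxnP _ m0 (fun m => rlmin p m && (pos p m < pos p v))
    (fun m => pos p m) m0P.
have ltmv : m < v.
  rewrite ltnNge leq_eqVlt; apply/negP.
  case/orP => [/eqP/val_inj eqv | /(rlminP _ _ rlm)].
    by rewrite eqv ltnn in ltm.
  by rewrite ltnNge ltnW.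
apply: (leq_trans _ (leq_bigmax_cond _ ltmv)).
rewrite (cardsD1 m) inE rlm ltm add1n ltnS; apply/subset_leq_card/subsetP => x.
rewrite !inE => /and3P[nexm rlx ltx]; rewrite rlx ltn_neqAle pos_eq nexm /=.
by apply: maxm; rewrite rlx.
Qed.

Lemma descent_bottom (i j : 'I_n) : i < j -> p j < p i ->
  exists k k' : 'I_n, [/\ k' = k.+1 :> nat, i <= k, k' <= j & p k' < p k].
Proof.
move=> ltij ltp.
have [k /andP[ltik ltk] mink] :=
  @arg_minnP _ j (fun k => (i < k) && (p k < p i)) val
    (introT andP (conj ltij ltp)).
(* At the first position [k] after [i] whose entry is below [p i], the preceding
   entry is at least [p i]. *)
have ltk1 : k.-1 < n by have := ltn_ord k; lia.
exists (Ordinal ltk1), k; split=> /=; [lia | lia | apply: mink; exact/andP |].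
rewrite ltnNge; apply/negP => lepk.
have [eqik | neik] := eqVneq i (Ordinal ltk1).
  by move: lepk; rewrite -eqik leqNgt ltk.
have ltik1 : i < Ordinal ltk1.
  by rewrite ltn_neqAle val_eqE neik /=; lia.
have := mink (Ordinal ltk1).
by rewrite ltik1 (leq_ltn_trans lepk ltk) /= => /(_ isT); lia.
Qed.

(** If [b > a] is written before [a], some descent bottom lies after [b] and not
    after [a]; by avoidance it closes a factor.  Either it separates [b] from
    [a], or it is [a] itself. *)
Lemma avoid_lists : p \in Sn_avoid n -> lists (block p) p.
Proof.
move=> /avoidP av a b ltab.
have neab : a != b by rewrite neq_ltn ltab.
rewrite block_first; apply/idP/orP => [ltpos | [ltw | /andP[/eqP eqw rla]]].
- have [|k [k' [eqk lek lek' ltk]]] := descent_bottom ltpos.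
    by rewrite !permKV.
  have rlx := av _ _ eqk ltk.
  have [eqx | nex] := eqVneq k' (pos p a).
    have := block_mono (ltnW ltpos); rewrite leq_eqVlt => /orP[eqw | ->].
      by right; rewrite eq_sym eqw -[a](permKV p) -eqx.
    by left.
  left; apply: (block_lt rlx); rewrite permK {1}eqk (leq_trans lek) //=.
  by rewrite ltn_neqAle val_eqE nex lek'.
- by rewrite ltnNge; apply: contraTN ltw => /block_mono; rewrite -leqNgt.
rewrite ltnNge leq_eqVlt pos_eq (negPf neab) /=; apply/negP => ltpos.
have := block_lt rla (introT andP (conj (leqnn _) ltpos)).
by rewrite eqw ltnn.
Qed.

End PermToWord.

End Listing.

(** * Equidistribution *)

Theorem theorem4p5 (n : nat) (hn : (1 <= n)%N) (R : comUnitRingType) (q t : R) :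
  \sum_(p in Sn_avoid n)
      q ^+ inversions (val \o p) * t ^+ descents (val \o p)
    = \sum_(w in W n)
        q ^+ (inversions (val \o w) + n - largest (val \o w))
          * t ^+ repeated (val \o w)
  /\ (q \is a GRing.unit ->
      \sum_(w in W n)
          q ^+ (inversions (val \o w) + n - largest (val \o w))
            * t ^+ repeated (val \o w)
        = q ^+ n * \sum_(w in W n)
            q ^ ((inversions (val \o w))%:Z - (largest (val \o w))%:Z)
              * t ^+ repeated (val \o w)).
Proof.
split=> [|uq]; last first.
  rewrite big_distrr; apply: eq_bigr => w; rewrite inE => rgw.
  rewrite /= mulrA; congr (_ * _).
  rewrite -addnBA ?largest_le // !exprnP -exprzDr // PoszD.
  by rewrite -subzn ?largest_le // addrCA.
pose phi (p : 'S_n) := [ffun v => inord (block p v) : 'I_n.+1].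
have phiE p : val \o phi p =1 block p.
  move=> v; rewrite /= ffunE inordK // ltnS.
  exact: leq_trans (rgword_le v (block_rgword p)) (ltn_ord v).
have rg_phi p : phi p \in W n.
  by rewrite inE (eq_rgword (phiE p)) block_rgword.
have lists_phi p : p \in Sn_avoid n -> lists (val \o phi p) p.
  by move=> /avoid_lists; apply: eq_lists => v; rewrite phiE.
have W_phi : W n = phi @: Sn_avoid n.
  apply/setP => w; apply/idP/imsetP => [Ww | [p _ ->] //].
  have rgw : rgword (val \o w) by rewrite inE in Ww.
  have [p wp] := ex_lists (val \o w).
  exists p; first exact: lists_avoid wp.
  apply/ffunP => v; apply/val_inj.
  rewrite -[LHS]/((val \o w) v) -[RHS]/((val \o phi p) v) phiE.
  exact: lists_block rgw wp v.
have inj_phi : {in Sn_avoid n &, injective phi}.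
  move=> p p' Sp Sp' eqphi; apply: lists_inj (lists_phi p Sp) _.
  by rewrite eqphi; apply: lists_phi.
rewrite W_phi big_imset //; apply: eq_bigr => p Sp.
have rgw : rgword (val \o phi p) by have := rg_phi p; rewrite inE.
by rewrite (lists_inversions rgw) ?(lists_descents rgw) //; apply: lists_phi.
Qed.
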